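(* Let $\mathcal R$ be the synchronous full-information system described in the context and let $r\in\mathcal R$. Let $\alpha_0=\langle i_0,t_0\rangle,\alpha_1,\dots,\alpha_k$ be nodes, and assume that $e_{\mathsf s}$ is an external input event that occurs at $\alpha_0=\langle i_0,t_0\rangle$ in $r$. If $$(\mathcal R,r)\vDash K_{\alpha_k}K_{\alpha_{k-1}}\cdots K_{\alpha_0}\,\mathsf{occurred}_{t_0}(e_{\mathsf s}),$$ then there is an uneven centipede for $\langle\alpha_0,\alpha_1,\dots,\alpha_k\rangle$ in $r$.
   Context: Model. $\mathbb P=\{1,\dots,n\}$ is a finite set of agents; time ranges over $\mathbb N$. A node is a pair $\langle i,t\rangle$ with $i\in\mathbb P$ and $t$ a time; $\mathbb V$ is the set of all nodes. The network is a fixed (commonly known) directed graph on $\mathbb P$ in which each channel $(i,j)$ carries a weight $max_{ij}$ (a positive integer), the upper bound on transmission time. A run $r$ is a function from times to global states; $r_i(t)$ is agent $i$'s local state at time $t$ in $r$. $\mathcal R$ is the set of all runs arising when the agents follow the full-information protocol in the following synchronous environment. (1) The environment nondeterministically chooses, at each time, an arbitrary (possibly empty) set of agents at which external input events occur and which external inputs occur there; this choice is unconstrained by other occurrences. An individual external input event is associated with a specific agent and occurs at a single node, i.e. at most once in a run. (2) Each agent has a fixed initial state and perfect recall: $r_i(t)$ is the complete time-stamped history of $i$ up to and including time $t$, including the external inputs and messages (with their senders) received at nodes $\langle i,t'\rangle$ with $t'\le t$. (3) At every node $\langle i,t\rangle$, agent $i$ sends a message containing $r_i(t)$ on every outgoing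 channel; any further local actions at $\langle i,t\rangle$ are a deterministic function of $r_i(t)$. (4) A message sent at $\langle i,t\rangle$ on channel $(i,j)$ is delivered at some $\langle j,t'\rangle$ with $t<t'\le t+max_{ij}$; the environment chooses delivery times nondeterministically and arbitrarily within this bound. Semantics. $(\mathcal R,r)\vDash\mathsf{occurred}_t(e)$ iff event $e$ has occurred in $r$ by time $t$. $(\mathcal R,r)\vDash K_{\langle i,t\rangle}\varphi$ iff $(\mathcal R,r')\vDash\varphi$ for all $r'\in\mathcal R$ with $r_i(t)=r'_i(t)$. Potential causality in $r$: $\rightsquigarrow$ is the smallest relation on nodes such that (i) $\langle i,t\rangle\rightsquigarrow\langle i,t'\rangle$ if $t\le t'$; (ii) $\langle i,t\rangle\rightsquigarrow\langle j,t'\rangle$ if some message is sent at $\langle i,t\rangle$ and received at $\langle j,t'\rangle$ in $r$; (iii) it is transitive. Bound guarantee: $\dashrightarrow$ is the smallest relation on nodes such that (i) $\langle i,t\rangle\dashrightarrow\langle i,t'\rangle$ if $t\le t'$; (ii) $\langle i,t\rangle\dashrightarrow\langle j,t+max_{ij}\rangle$ for every channel $(i,j)$; (iii) it is transitive. Uneven centipede: for a sequence of nodes $\langle\alpha_0,\dots,\alpha_k\rangle$, an uneven centipede in $r$ is a sequence of nodes $\langle\theta_0,\dots,\theta_k\rangle$ such that $\theta_0=\alpha_0$, $\theta_k=\alpha_k$, $\theta_0\rightsquigarrow\theta_1\rightsquigarrow\cdots\rightsquigarrow\theta_k$ in $r$, and $\theta_h\dashrightarrow\alpha_h$ for $h=1,\dots,k-1$.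 *)

(* Defs.v *)
From mathcomp Require Import all_boot.

Set Implicit Arguments.
Unset Strict Implicit.
Unset Printing Implicit Defensive.

Definition node (n : nat) : Type := 'I_n * nat.

(* A local state is a complete history with one layer per time step, so the
   time stamp of a layer is its depth. A layer records the external inputs and
   the received messages, each paired with its sender; the content of a message
   is the local state of the sender at sending time. Time 0 carries no messages
   because transmission takes at least one time unit. *)
Inductive lstate (n : nat) (E I : Type) : Type :=
| Start of I & pred E
| Next of lstate n E I & pred E & seq ('I_n * lstate n E I).

(* [chan] and [wmax] are the weighted network, [site e] is the agent with which
   the external input event [e] is associated, and [prot] gives the further
   local actions, which are a deterministic function of the local state. *)
Record scenario : Type := Scenario {
  nagents : nat;
  chan : rel 'I_nagents;
  wmax : 'I_nagents -> 'I_nagents -> nat;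
  wmax_gt0 : forall i j, chan i j -> 0 < wmax i j;
  event : Type;
  site : event -> 'I_nagents;
  istate : Type;
  init : 'I_nagents -> istate;
  action : Type;
  prot : 'I_nagents -> lstate nagents event istate -> action
}.

(* [inputs g i] are the external inputs occurring at [i] in the current round,
   and [delivers g a j] says that the message sent at the node [a] on the
   channel from [a.1] to [j] is delivered to [j] in the current round. *)
Record gstate (M : scenario) : Type := GState {
  loc : 'I_(nagents M) -> lstate (nagents M) (event M) (istate M);
  acts : 'I_(nagents M) -> action M;
  inputs : 'I_(nagents M) -> pred (event M);
  delivers : node (nagents M) -> 'I_(nagents M) -> bool
}.

Definition run (M : scenario) : Type := nat -> gstate M.

Definition local_state (M : scenario) (r : run M) (a : node (nagents M)) :=
  loc (r a.2) a.1.

Definition occurs_at (M : scenario) (r : run M) (e : event M)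
  (a : node (nagents M)) : bool := inputs (r a.2) a.1 e.

Definition message (M : scenario) (r : run M) (a b : node (nagents M)) : bool :=
  delivers (r b.2) a b.1.

(* The messages received at [b], listed by sender and then by sending time.
   This fixed order carries no information: it represents a set, since
   different sending times give contents of different depths. *)
Definition inbox (M : scenario) (r : run M) (b : node (nagents M)) :
    seq ('I_(nagents M) * lstate (nagents M) (event M) (istate M)) :=
  [seq (a.1, local_state r a) |
     a <- [seq (i, s) | i <- enum 'I_(nagents M), s <- iota 0 b.2]
       & message r a b].

Record in_system (M : scenario) (r : run M) : Prop := InSystem {
  input_site : forall e a, occurs_at r e a -> a.1 = site e;
  input_once : forall e a b, occurs_at r e a -> occurs_at r e b -> a = b;
  loc_start : forall i,
    local_state r (i, 0) = Start (nagents M) (init i) (inputs (r 0) i);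
  loc_next : forall i t,
    local_state r (i, t.+1) =
    Next (local_state r (i, t)) (inputs (r t.+1) i) (inbox r (i, t.+1));
  acts_prot : forall i t, acts (r t) i = prot i (local_state r (i, t));
  (* Every agent sends on all its outgoing channels at all times. *)
  msg_delivered : forall i j t, chan i j -> exists t', message r (i, t) (j, t');
  msg_once : forall a j t t',
    message r a (j, t) -> message r a (j, t') -> t = t';
  msg_bounds : forall a b, message r a b ->
    chan a.1 b.1 /\ a.2 < b.2 <= a.2 + wmax a.1 b.1
}.

(* Formulas are interpreted as predicates on runs. *)
Definition formula (M : scenario) : Type := run M -> Prop.

Definition occurred (M : scenario) (t : nat) (e : event M) : formula M :=
  fun r => exists a : node (nagents M), a.2 <= t /\ occurs_at r e a.

Definition knows (M : scenario) (a : node (nagents M)) (phi : formula M) :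
    formula M :=
  fun r => forall r' : run M, in_system r' ->
    local_state r a = local_state r' a -> phi r'.

(* For [s = a_0 :: ... :: a_k :: nil] this is K_{a_k} (... (K_{a_0} phi)): the
   last node of the sequence is the outermost operator. *)
Definition nested_knows (M : scenario) (s : seq (node (nagents M)))
    (phi : formula M) : formula M :=
  foldl (fun psi a => knows a psi) phi s.

Inductive causes (M : scenario) (r : run M) :
    node (nagents M) -> node (nagents M) -> Prop :=
| causes_local i t t' : t <= t' -> causes r (i, t) (i, t')
| causes_message a b : message r a b -> causes r a b
| causes_trans a b c : causes r a b -> causes r b c -> causes r a c.

Inductive guarantees (M : scenario) : node (nagents M) -> node (nagents M) -> Prop :=
| guarantees_local i t t' : t <= t' -> guarantees (i, t) (i, t')
| guarantees_chan i j t : chan i j -> guarantees (i, t) (j, t + wmax i j)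
| guarantees_trans a b c : guarantees a b -> guarantees b c -> guarantees a c.

Definition uneven_centipede (M : scenario) (r : run M) (k : nat)
    (alpha theta : k.+1.-tuple (node (nagents M))) : Prop :=
  [/\ tnth theta ord0 = tnth alpha ord0,
      tnth theta ord_max = tnth alpha ord_max,
      forall h h' : 'I_k.+1, h' = h.+1 :> nat ->
        causes r (tnth theta h) (tnth theta h')
    & forall h : 'I_k.+1, 0 < h < k ->
        guarantees (tnth theta h) (tnth alpha h)].

(* Main.v *)
(** Given [r] and a node [b], let [r'] agree with [r] on the causal past of [b];
    outside that past no external input occurs and every message takes
    maximal time. The node [b] cannot distinguish [r'] from [r], so [r']
    satisfies the nested knowledge formula without its outermost operator, and
    by induction it has a centipede for the shorter sequence of nodes. Every
    causal step of [r'] that leads outside the past of [b] is a bound guarantee.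
    Replacing all nodes of the centipede that lie outside the past by the last
    node of its body inside the past therefore gives a centipede in [r], which
    extends to [b]. *)
Require Import Defs.
From mathcomp Require Import all_boot boolp.

Set Implicit Arguments.
Unset Strict Implicit.
Unset Printing Implicit Defensive.

Section BuildRun.
Variable M : scenario.
Local Notation agent := 'I_(nagents M).
Local Notation state := (lstate (nagents M) (event M) (istate M)).
Variable (inp : node (nagents M) -> pred (event M)).
Variable (del : rel (node (nagents M))).

(** Counterpart of [inbox] for a run still under construction: message contents are read from a
    table [h] of earlier states. *)
Definition received (h : nat -> agent -> state) (b : node (nagents M)) :
    seq (agent * state) :=
  [seq (a.1, h a.2 a.1) |
     a <- [seq (i, s) | i <- enum agent, s <- iota 0 b.2] & del a b].

(* [history t s] is the intended state at time [s] for [s <= t] only. *)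
Fixpoint history (t : nat) : nat -> agent -> state :=
  if t is u.+1 then
    fun s i => if s <= u then history u s i else
      Next (history u u i) (inp (i, u.+1))
        (received (history u) (i, u.+1))
  else fun _ i => Start (nagents M) (init i) (inp (i, 0)).

Definition build_run : run M := fun t =>
  GState (fun i => history t t i) (fun i => prot i (history t t i))
    (fun i => inp (i, t)) (fun a j => del a (j, t)).

Lemma history_diag t s : s <= t -> history t s = history s s.
Proof.
elim: t => [|t IH]; first by rewrite leqn0 => /eqP ->.
by rewrite leq_eqVlt => /orP[/eqP -> //|lt_st]; rewrite -(IH lt_st) /= -ltnS lt_st.
Qed.

Lemma build_run_next i t :
  local_state build_run (i, t.+1) =
  Next (local_state build_run (i, t)) (inp (i, t.+1))
    (inbox build_run (i, t.+1)).
Proof.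
rewrite /local_state /= ltnn; congr Next.
apply/eq_in_map => x; rewrite mem_filter => /andP[_ /allpairsP[[j v] [_]]].
by rewrite mem_iota /= => lt_v ->; rewrite /local_state /= history_diag.
Qed.

End BuildRun.

Section Rerouting.
Variables (M : scenario) (r : run M) (b : node (nagents M)).
Hypothesis sys_r : in_system r.
Local Notation node := (node (nagents M)).

Definition past (x : node) : bool := `[< causes r x b >].

Lemma past_local i t t' : t <= t' -> past (i, t') -> past (i, t).
Proof.
by move=> le_t /asboolP c; apply/asboolP/causes_trans/c/causes_local.
Qed.

Lemma past_message x y : message r x y -> past y -> past x.
Proof.
by move=> m /asboolP c; apply/asboolP/causes_trans/c/causes_message.
Qed.

(* The last conjunct excludes a second delivery: a message may reach the past
   of [b] before its deadline, which may lie outside that past. *)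
Definition late_message : rel node := fun x y =>
  if past y then message r x y else
  [&& chan x.1 y.1, y.2 == x.2 + wmax x.1 y.1 &
      ~~ `[< exists t, past (y.1, t) /\ message r x (y.1, t) >] ].

Definition past_inputs (x : node) : pred (event M) :=
  if past x then inputs (r x.2) x.1 else pred0.

Definition late_run : run M := build_run past_inputs late_message.

Lemma occurs_late_run e x :
  occurs_at late_run e x = past x && occurs_at r e x.
Proof. by case: x => i t; rewrite /occurs_at /= /past_inputs; case: ifP. Qed.

Lemma message_late_run x y : message late_run x y = late_message x y.
Proof. by case: y. Qed.

Lemma late_message_bounds x y : late_message x y ->
  chan x.1 y.1 /\ x.2 < y.2 <= x.2 + wmax x.1 y.1.
Proof.
rewrite /late_message; case: ifP => [_ /(msg_bounds sys_r) //|_].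
case/and3P => ch /eqP -> _; split => //.
by rewrite leqnn andbT -addn1 leq_add2l (wmax_gt0 ch).
Qed.

Lemma late_run_in_system : in_system late_run.
Proof.
split.
- by move=> e a; rewrite occurs_late_run => /andP[_ /(input_site sys_r)].
- move=> e x y; rewrite !occurs_late_run => /andP[_ ox] /andP[_ oy].
  exact: (input_once sys_r ox oy).
- by [].
- by move=> i t; apply: build_run_next.
- by [].
- move=> i j t ch; have [t' m] := msg_delivered sys_r t ch.
  case pt': (past (j, t')); first by exists t'; rewrite message_late_run /late_message pt'.
  exists (t + wmax i j); rewrite message_late_run /late_message /= ch eqxx /=.
  (* The deadline is not before [t'], hence outside the past; a delivery inside the past would have
     to be the one at [t']. *)
  have [_ /= /andP[_ le_t']] := msg_bounds sys_r m.
  case: ifP => [/(past_local le_t')|_]; first by rewrite pt'.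
  apply/asboolPn => -[t'' [pt'' m'']].
  by rewrite (msg_once sys_r m m'') pt'' in pt'.
- move=> x j t t'; rewrite !message_late_run /late_message /=.
  case: ifP => pt; case: ifP => pt'.
  + exact: msg_once.
  + by move=> m /and3P[_ _ /asboolPn[]]; exists t.
  + by move=> /and3P[_ _ /asboolPn nex] m; case: nex; exists t'.
  + by move=> /and3P[_ /eqP -> _] /and3P[_ /eqP -> _].
- by move=> x y; rewrite message_late_run; apply: late_message_bounds.
Qed.

(** The past is closed under going back in time at an agent and from a receipt to its sending, so
    strong induction on time applies to the previous state and to the contents of the inbox. *)
Lemma late_run_local_state x :
  past x -> local_state late_run x = local_state r x.
Proof.
have [n] := ubnP x.2; elim: n x => // n IH [i [|t]] /= lt_n px.
  by rewrite (loc_start sys_r) (loc_start late_run_in_system) /= /past_inputs px.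
rewrite (loc_next sys_r) (loc_next late_run_in_system) /= /past_inputs px.
rewrite IH ?(past_local (leqnSn t)) //; congr Next.
have eq_msg x : message late_run x (i, t.+1) = message r x (i, t.+1).
  by rewrite message_late_run /late_message px.
rewrite /inbox (eq_filter eq_msg).
apply/eq_in_map => x; rewrite mem_filter => /andP[m _].
have [_ /andP[lt_x _]] := msg_bounds sys_r m.
by rewrite IH ?(past_message m) // (leq_trans lt_x).
Qed.

Lemma guarantees_refl (x : node) : guarantees x x.
Proof. by case: x => i t; apply: guarantees_local. Qed.

(* [x] is the last node in the past of [b] on a path of [late_run] to [y]. *)
Definition exits_at (x y : node) : Prop :=
  past x /\ (x = y \/ ~~ past y /\ guarantees x y).

Lemma exits_at_guarantees x y : exits_at x y -> guarantees x y.
Proof. by case=> _ [->|[]//]; apply: guarantees_refl. Qed.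

(** If [z] is in the past then so is [y], which forces [x = y] and allows [w = z]; otherwise
    [w = x], and the guarantee up to [y] is prolonged to [z]. *)
Lemma exits_at_edge x y z :
  (past z -> past y /\ causes r y z) -> (~~ past z -> guarantees y z) ->
  exits_at x y -> exists2 w, causes r x w & exits_at w z.
Proof.
move=> inside outside ex; have [px xy] := ex.
case: (boolP (past z)) => [pz|npz].
  have [py cyz] := inside pz; case: xy => [->|[]]; last by rewrite py.
  by exists z => //; split => //; left.
exists x; first by case: (x) => i t; apply: causes_local.
split=> //; right; split=> //.
exact: guarantees_trans (exits_at_guarantees ex) (outside npz).
Qed.

Lemma exits_at_causes x y z : causes late_run y z ->
  exits_at x y -> exists2 w, causes r x w & exits_at w z.
Proof.
move=> cyz; elim: cyz x => {y z} [i t t' le_t|y z m|u v w _ IHuv _ IHvw] x.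
- apply: exits_at_edge => [pz|_]; last exact: guarantees_local.
  by split; [apply: past_local pz | apply: causes_local].
- move: m; rewrite message_late_run /late_message; case: ifP => pz.
    move=> m; apply: exits_at_edge; rewrite pz //.
    by split; [apply: past_message m pz | apply: causes_message].
  (* A delivery outside the past takes exactly the maximal time of its channel. *)
  case: y z pz => [i t] [j t'] + /= /and3P[ch /eqP t'E _]; rewrite t'E => pz.
  by apply: exits_at_edge; rewrite pz // => _; apply: guarantees_chan.
- case/IHuv => x' cx /IHvw[x'' cx' ex]; exists x'' => //.
  exact: causes_trans cx cx'.
Qed.

End Rerouting.

Section Centipede.
Variable M : scenario.
Local Notation node := (node (nagents M)).

(** Recursive form of an uneven centipede with ends [a] and [b]; [s] lists the interior nodes, the
    only ones that need a bound guarantee. *)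
Fixpoint centipede (r : run M) (a : node) (s : seq node) (b : node) : Prop :=
  if s is c :: s' then
    exists x, [/\ causes r a x, guarantees x c & centipede r x s' b]
  else causes r a b.

(** The start is generalised to [a'] because the induction continues from exit nodes. The old end
    [c] becomes interior: its exit node guarantees it and, lying in the past, causes [b]. *)
Lemma centipede_late_run (r : run M) (b c a a' : node) s :
  exits_at r b a' a -> centipede (late_run r b) a s c ->
  centipede r a' (rcons s c) b.
Proof.
elim: s a a' => [|d s IH] a a' ex /=.
  move=> /exits_at_causes/(_ ex)[w caw exw].
  exists w; split=> //; first exact: exits_at_guarantees exw.
  by case: exw => /asboolP.
case=> x [/exits_at_causes/(_ ex)[w caw exw] gxd cent]; exists w; split=> //.
  exact: guarantees_trans (exits_at_guarantees exw) gxd.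
exact: IH exw cent.
Qed.

Lemma nested_knows_rcons (s : seq node) b (phi : formula M) :
  nested_knows (rcons s b) phi = knows b (nested_knows s phi).
Proof. by rewrite /nested_knows -cats1 foldl_cat. Qed.

(** Knowledge is factual, since a run is indistinguishable from itself. *)
Lemma nested_knows_true (s : seq node) (phi : formula M) (r : run M) :
  in_system r -> nested_knows s phi r -> phi r.
Proof.
move=> sys; elim/last_ind: s => [//|s b IH]; rewrite nested_knows_rcons => kb.
exact/IH/kb.
Qed.

Lemma nested_knows_centipede (r : run M) e a s b :
  in_system r -> occurs_at r e a ->
  nested_knows (a :: rcons s b) (occurred a.2 e) r -> centipede r a s b.
Proof.
elim/last_ind: s r b => [|s c IH] r b sys oa; rewrite -rcons_cons nested_knows_rcons.
all: have pb : past r b b by apply/asboolP; case: (b) => i t; apply: causes_local.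
all: have sys' := late_run_in_system b sys.
all: move=> /(_ _ sys' (esym (late_run_local_state sys pb))) ks.
(* The event has occurred in the late run, so at a node in the past of [b] where it also occurs in
   [r]. As it occurs only once in [r], this node is [a]. *)
all: have [x [_ ox]] := nested_knows_true sys' ks.
all: have /andP[px orx] : past r b x && occurs_at r e x by rewrite -occurs_late_run.
all: have eqx := input_once sys orx oa; subst x.
  exact/asboolP.
by apply: (centipede_late_run _ (IH _ _ sys' ox ks)); split=> //; left.
Qed.

Lemma centipede_nodes (r : run M) a s b : centipede r a s b ->
  exists th : seq node, [/\ size th = size s,
    forall x0 h, h <= size s ->
      causes r (nth x0 (a :: rcons th b) h) (nth x0 (a :: rcons th b) h.+1) &
    forall x0 h, h < size s -> guarantees (nth x0 th h) (nth x0 s h)].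
Proof.
elim: s a => [|c s IH] a /=; first by exists [::]; split=> // x0 [].
case=> x [cax gxc /IH[th [sz cth gth]]].
exists (x :: th); split=> [|x0 [|h]|x0 [|h]] //=; first by rewrite sz.
- exact: cth.
- exact: gth.
Qed.

End Centipede.

Theorem theorem5 (M : scenario) (r : run M) (k : nat)
  (alpha : k.+1.-tuple (node (nagents M))) (es : event M) :
  in_system r ->
  occurs_at r es (tnth alpha ord0) ->
  nested_knows alpha (occurred (tnth alpha ord0).2 es) r ->
  exists theta : k.+1.-tuple (node (nagents M)), uneven_centipede r alpha theta.
Proof.
move=> sys; case: k alpha => [|k] alpha.
  by exists alpha; split=> // -[[|h] lt_h] // [[|h'] lt_h'].
(* Now [alpha] has [k.+2] entries: two ends and [k] interior nodes. *)
case: alpha => -[|a s] sz_s; first by have := sz_s.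
case/lastP: s sz_s => [|s b] sz_s; first by have := sz_s.
rewrite (tnth_nth a) /= => oa /(nested_knows_centipede sys oa).
case/centipede_nodes => th [sz cth gth].
have sz_k : size s = k by move: (sz_s); rewrite /= size_rcons => /eqP[].
have sz_th : size (a :: rcons th b) == k.+2 by rewrite /= size_rcons sz sz_k.
exists (Tuple sz_th); split.
- by rewrite !(tnth_nth a).
- by rewrite !(tnth_nth a) /= !nth_rcons sz sz_k ltnn eqxx.
- move=> h h' eq_h; rewrite !(tnth_nth a) eq_h; apply: cth.
  by rewrite sz_k -ltnS -ltnS -eq_h.
- case=> -[|h] lt_h //=; rewrite ltnS => lt_hk.
  by rewrite !(tnth_nth a) /= !nth_rcons sz sz_k lt_hk; apply: gth; rewrite sz_k.
Qed.
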